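(* (Generalised Gärtner-Ellis theorem.) Let $X$ be a Hausdorff topological space, $Y$ a Polish space, and $b:X\times Y\to\mathbb{R}\cup\{-\infty\}$ a kernel satisfying the standing assumptions of the context. Let $(F_n)_{n\in\mathbb{N}}$ be a sequence in $\mathcal{QL}(C_b(Y))$ such that $\lim_{n\to\infty}\rho(F_n)=0$, let $g:X\to\overline{\mathbb{R}}$ be given by $$g(x)=\limsup_{n\to\infty}F_n(b(x,\cdot))\quad\text{for all }x\in X,$$ and assume that this limsup is a limit (for every $x\in X$). Assume that either $Y$ is discrete, or ($b$ is continuous in the second variable and $B^\circ g(y)>-\infty$ for all $y\in Y$); that $b$ is strongly coercive; that $B^\circ g$ is quasi-continuous on its domain; and that there exists $x_0\in\operatorname{idom}(g)$ such that $b(x_0,\cdot)$ is bounded below by some real constant. Let $\overline{F}$ be the continuous max-plus linear form with density $B^\circ g$. Then: (i) There exist $F\in\mathcal{L}(C_b(Y))$ and a subsequence of $(F_n)_{n\in\mathbb{N}}$ which converges weakly towards $F$. (ii) $\{(\partial^\circ g)^{-1}(y)\}_{y\in\operatorname{ldom}(B^\circ g)}$ is a covering of $\operatorname{idom}(g)$. (iii) If $F$ is an accumulation point of $(F_n)_{n\in\mathbb{N}}$ for the weak convergence, and $f$ is the l.s.c. density of $F$, then $f\ge B^\circ g$. Hence $\limsup_{n\to\infty}F_n(C)\le\overline{F}(C)$ for all closed $C\subset Y$. (iv) Let $Z=Z_a\cup\operatorname{int}(Z_t)$, where $Z_a$ (resp. $Z_t$) is the set of algebraically (resp. topologically) essential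 elements $y\in\operatorname{ldom}(B^\circ g)$ with respect to the covering of $\operatorname{idom}(g)$ in (ii), and $\operatorname{int}(Z_t)$ is the interior of $Z_t$ relative to $\operatorname{dom}(B^\circ g)$. If $F$ and $f$ are as in (iii), then $f=B^\circ g$ on $Z$. Hence $\liminf_{n\to\infty}F_n(G)\ge\overline{F}(G\cap Z)$ for all open $G\subset Y$. (v) If $\{(\partial^\circ g)^{-1}(y)\}_{y\in\operatorname{ldom}(B^\circ g)}$ is a topologically minimal covering of $\operatorname{idom}(g)$, then $F_n$ weakly converges towards $\overline{F}$.
   Context: Conventions: $\overline{\mathbb{R}}=\mathbb{R}\cup\{\pm\infty\}$, $-\infty$ is absorbing for addition (so $(-\infty)+(+\infty)=-\infty$), and $a-b$ means $a+(-b)$. $\mathbb{R}_{\max}=\mathbb{R}\cup\{-\infty\}$ (with its usual topology), $\vee$ is the (pointwise) maximum, functions are ordered pointwise, ''l.s.c.'' means lower semicontinuous. Standing assumptions on $b$: $b:X\times Y\to\mathbb{R}\cup\{-\infty\}$ is l.s.c. in the second variable; for every $x\in X$ there is $y\in Y$ with $b(x,y)\in\mathbb{R}$, and for every $y\in Y$ there is $x\in X$ with $b(x,y)\in\mathbb{R}$. Conjugacy and subdifferential: for $g:X\to\overline{\mathbb{R}}$, $B^\circ g(y)=\sup_{x\in X}\big(b(x,y)-g(x)\big)$, $y\in Y$. For $x\in X$, $\partial^\circ g(x)=\{y\in Y: b(x,y)\in\mathbb{R},\ b(x',y)-g(x')\le b(x,y)-g(x)\ \forall x'\in X\}$, and $(\partial^\circ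 g)^{-1}(y)=\{x\in X: y\in\partial^\circ g(x)\}$. Domains: for a map $h$ from a topological space $S$ to $\overline{\mathbb{R}}$, $\operatorname{ldom}(h)=\{s:h(s)<+\infty\}$, $\operatorname{dom}(h)=\{s:h(s)\in\mathbb{R}\}$, $\operatorname{idom}(h)=\{s\in\operatorname{dom}(h):\limsup_{s'\to s}h(s')<+\infty\}$. $h$ is quasi-continuous if for every open $G\subset\overline{\mathbb{R}}$, $h^{-1}(G)$ is contained in the closure of its interior; ''quasi-continuous on its domain'' means that the restriction of $h$ to $\operatorname{dom}(h)$ (with the relative topology) is quasi-continuous. Coverings: a family $\{\Phi(z)\}_{z\in Z'}$ of subsets of a set is a covering of $W'$ if $\bigcup_{z\in Z'}\Phi(z)\supset W'$. An element $y\in Z'$ is algebraically essential if $W'\not\subset\bigcup_{z\in Z'\setminus\{y\}}\Phi(z)$; when $Z'$ carries a topology, $y$ is topologically essential if $W'\not\subset\bigcup_{z\in Z'\setminus U}\Phi(z)$ for every open neighbourhood $U$ of $y$ in $Z'$. The covering is topologically minimal if all elements of $Z'$ are topologically essential. (Here $Z'=\operatorname{ldom}(B^\circ g)\subset Y$ with the relative topology.) Strongly coercive: for $x\in X$, $W\subset X$, put $b_{x,W}(y)=\sup_{z\in W}b(z,y)-b(x,y)$. $b$ is strongly coercive if for all $x\in X$ and all neighbourhoods $V$ of $x$ there is a finite subset $W\subset V$ such that $\{y\in Y:b_{x,W}(y)\le\beta\}$ is relatively compact for all $\beta\in\mathbb{R}$. Function spaces: $(\mathbb{R}_{\max})^Y$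 is the set of functions $Y\to\mathbb{R}_{\max}$; $\mathrm{lsc}(Y)$ is the subset of l.s.c. functions; $C_b(Y)$ is the subset of continuous functions bounded above by a real constant. Quasi-linear forms: a map $F:C_b(Y)\to\overline{\mathbb{R}}$ is a quasi-(max-plus-)linear form if it is isotone, additively homogeneous ($F(\lambda+\varphi)=\lambda+F(\varphi)$ for all $\lambda\in\mathbb{R}_{\max}$), and there exists $\alpha\in\mathbb{R}_{\max}$ such that $F(\varphi\vee\psi)\le\alpha+F(\varphi)\vee F(\psi)$ for all $\varphi,\psi$; $\rho(F)$ denotes the infimum of such $\alpha$. $F$ is continuous if $F(\varphi_k)\to F(\varphi)$ whenever $\varphi_k\in C_b(Y)$ is nondecreasing in $k$ and converges pointwise to $\varphi\in C_b(Y)$. $\mathcal{QL}(C_b(Y))$ is the set of continuous quasi-linear forms $C_b(Y)\to\mathbb{R}_{\max}$, and $\mathcal{L}(C_b(Y))=\{F\in\mathcal{QL}(C_b(Y)):\rho(F)\le0\}$ (the continuous max-plus linear forms with values in $\mathbb{R}_{\max}$). Each $F\in\mathcal{L}(C_b(Y))$ has a unique l.s.c. density, i.e. a unique l.s.c. $f:Y\to\overline{\mathbb{R}}$ with $F(\varphi)=\sup_{y\in Y}(\varphi(y)-f(y))$ for all $\varphi\in C_b(Y)$. Extension: $F\in\mathcal{QL}(C_b(Y))$ is extended to $\mathrm{lsc}(Y)$ by $F(\varphi)=\sup\{F(\psi):\psi\in C_b(Y),\ \psi\le\varphi\}$, then to $(\mathbb{R}_{\max})^Y$ by $F(\varphi)=\inf\{F(\psi):\psi\in\mathrm{lsc}(Y),\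 \psi\ge\varphi\}$, with values in $\overline{\mathbb{R}}$. For $A\subset Y$, $F(A):=F(\mathbf{1}_A)$, where $\mathbf{1}_A(y)=0$ if $y\in A$ and $-\infty$ otherwise. The form $\overline{F}$ is $\overline{F}(\varphi)=\sup_{y\in Y}(\varphi(y)-B^\circ g(y))$, so that $\overline{F}(A)=\sup_{y\in A}(-B^\circ g(y))$. Weak convergence: $F_n$ weakly converges towards $F$ if $\lim_nF_n(\varphi)=F(\varphi)$ for all $\varphi\in C_b(Y)$; $F$ is an accumulation point of $(F_n)$ for the weak convergence if some subsequence weakly converges towards $F$. *)

(* Defs.v *)
From mathcomp Require Export all_boot all_order all_algebra.
From mathcomp Require Export all_classical all_reals all_analysis.
Import Order.TTheory GRing.Theory Num.Theory.
Import numFieldNormedType.Exports.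

Set Implicit Arguments.
Unset Strict Implicit.
Unset Printing Implicit Defensive.

Local Open Scope classical_set_scope.
Local Open Scope ring_scope.
Local Open Scope ereal_scope.

(* Throughout, the addition of \bar R is [adde], for which -oo is absorbing
   (-oo + +oo = -oo), and x - y is x + (- y).  Values in R_max, i.e. in
   R \cup {-oo}, are elements of \bar R that are < +oo. *)

Section Spaces.
Context {R : realType}.

Definition is_metric (T : Type) (d : T -> T -> R) : Prop :=
  [/\ forall x y, (0 <= d x y)%R,
      forall x y, d x y = 0%R <-> x = y,
      forall x y, d x y = d y x &
      forall x y z, (d x z <= d x y + d y z)%R].

Definition metric_induces_topology (T : topologicalType) (d : T -> T -> R) :=
  forall x : T,
    nbhs x = filter_from [set e : R | (0 < e)%R] (fun e => [set y | (d x y < e)%R]).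

Definition complete_metric (T : topologicalType) (d : T -> T -> R) :=
  forall u : nat -> T,
    (forall e : R, (0 < e)%R ->
       exists N : nat, forall m n, (N <= m)%N -> (N <= n)%N -> (d (u m) (u n) < e)%R) ->
    exists l : T, u n @[n --> \oo] --> l.

Definition separable (T : topologicalType) :=
  exists2 D : set T, countable D & dense D.

Definition discrete_space (T : topologicalType) := forall A : set T, open A.

End Spaces.

Definition polish (R : realType) (T : topologicalType) : Prop :=
  separable T /\
  exists d : T -> T -> R,
    [/\ is_metric d, metric_induces_topology d & complete_metric d].

Section Domains.
Context {R : realType} {S : topologicalType}.
Implicit Type h : S -> \bar R.

Definition ldom h : set S := [set s | h s < +oo].

Definition edom h : set S := [set s | h s \is a fin_num].

(* The neighbourhoods of s contain s; as h s is finite, this limsup is < +oo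
   iff the one over punctured neighbourhoods is. *)
Definition idom h : set S := [set s | edom h s /\ limf_esup h (nbhs s) < +oo].

Definition quasi_continuous h : Prop :=
  forall G : set (\bar R), open G -> h @^-1` G `<=` closure (interior (h @^-1` G)).

End Domains.

(* [subspace D] carries the topology of T in which D is clopen with its
   relative topology and the points outside D are isolated; the latter satisfy
   the defining condition of quasi-continuity trivially. *)
Definition quasi_continuous_on_domain {R : realType} {S : topologicalType}
    (h : S -> \bar R) : Prop :=
  quasi_continuous (h : subspace (edom h) -> \bar R).

Definition relative_interior {T : topologicalType} (D A : set T) : set T :=
  D `&` @interior (subspace D) A.

Section Coverings.
Context {T : topologicalType} {U : Type}.
Variables (Z : set T) (Phi : T -> set U) (W : set U).

Definition is_covering : Prop := W `<=` \bigcup_(z in Z) Phi z.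

Definition algebraically_essential (y : T) : Prop :=
  Z y /\ ~ (W `<=` \bigcup_(z in Z `\ y) Phi z).

Definition topologically_essential (y : T) : Prop :=
  Z y /\
  forall N : set (subspace Z), open_nbhs (y : subspace Z) N ->
    ~ (W `<=` \bigcup_(z in Z `\` N) Phi z).

Definition topologically_minimal_covering : Prop :=
  is_covering /\ forall y, Z y -> topologically_essential y.

End Coverings.

Section Conjugacy.
Context {R : realType} {X Y : topologicalType}.
Variable b : X -> Y -> \bar R.

Definition kernel_assumptions : Prop :=
  [/\ forall x y, b x y < +oo,
      forall x, lower_semicontinuous (b x),
      forall x, exists y, b x y \is a fin_num &
      forall y, exists x, b x y \is a fin_num].

Definition conjugate (g : X -> \bar R) (y : Y) : \bar R :=
  ereal_sup (range (fun x => b x y - g x)).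

Definition subdifferential (g : X -> \bar R) (x : X) : set Y :=
  [set y | b x y \is a fin_num /\ forall x', b x' y - g x' <= b x y - g x].

Definition subdifferential_inv (g : X -> \bar R) (y : Y) : set X :=
  [set x | subdifferential g x y].

Definition b_diff (x : X) (W : set X) (y : Y) : \bar R :=
  ereal_sup [set b z y | z in W] - b x y.

Definition strongly_coercive : Prop :=
  forall (x : X) (V : set X), nbhs x V ->
    exists W : set X, [/\ finite_set W, W `<=` V &
      forall beta : R, precompact [set y | b_diff x W y <= beta%:E]].

End Conjugacy.

Section Forms.
Context {R : realType} {Y : topologicalType}.

(* Being bounded above by a real, the elements of C_b never take the value +oo;
   the topology of R_max is the one induced by \bar R. *)
Definition C_b : set (Y -> \bar R) :=
  [set phi | continuous phi /\ exists M : R, forall y, phi y <= M%:E].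

Definition lsc : set (Y -> \bar R) :=
  [set phi | (forall y, phi y < +oo) /\ lower_semicontinuous phi].

(* A map C_b(Y) -> \bar R is represented by a function on all of Y -> \bar R,
   of which only the values on C_b are ever used. *)
Definition form := (Y -> \bar R) -> \bar R.
Implicit Types F : form.

Definition isotone F : Prop :=
  forall phi psi, C_b phi -> C_b psi ->
    (forall y, phi y <= psi y) -> F phi <= F psi.

Definition additively_homogeneous F : Prop :=
  forall (lambda : \bar R) phi, lambda < +oo -> C_b phi ->
    F (fun y => lambda + phi y) = lambda + F phi.

(* alpha + F(phi) \/ F(psi) is read as alpha + (F(phi) \/ F(psi)). *)
Definition quasi_additive F (alpha : \bar R) : Prop :=
  forall phi psi, C_b phi -> C_b psi ->
    F (fun y => maxe (phi y) (psi y)) <= alpha + maxe (F phi) (F psi).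

Definition quasi_linear_form F : Prop :=
  [/\ isotone F, additively_homogeneous F &
      exists2 alpha : \bar R, alpha < +oo & quasi_additive F alpha].

Definition rho F : \bar R :=
  ereal_inf [set alpha | alpha < +oo /\ quasi_additive F alpha].

Definition continuous_form F : Prop :=
  forall (phi_ : nat -> Y -> \bar R) phi,
    (forall k, C_b (phi_ k)) -> C_b phi ->
    (forall y, nondecreasing_seq (phi_ ^~ y)) ->
    (forall y, phi_ k y @[k --> \oo] --> phi y) ->
    F (phi_ k) @[k --> \oo] --> F phi.

Definition QL : set form :=
  [set F | [/\ quasi_linear_form F, continuous_form F &
              forall phi, C_b phi -> F phi < +oo]].

Definition maxplus_L : set form := [set F | QL F /\ rho F <= 0].

(* [ext] is meant for functions Y -> R_max; on l.s.c. ones it agrees with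
   [ext_lsc], and on C_b with F, when F is isotone. *)
Definition ext_lsc F : form := fun phi =>
  ereal_sup [set F psi | psi in [set psi | C_b psi /\ forall y, psi y <= phi y]].

Definition ext F : form := fun phi =>
  ereal_inf [set ext_lsc F psi | psi in [set psi | lsc psi /\ forall y, phi y <= psi y]].

Definition indic_max (A : set Y) (y : Y) : \bar R := if y \in A then 0 else -oo.

Definition form_of_density (f : Y -> \bar R) : form := fun phi =>
  ereal_sup (range (fun y => phi y - f y)).

Definition is_lsc_density F (f : Y -> \bar R) : Prop :=
  lower_semicontinuous f /\ forall phi, C_b phi -> F phi = form_of_density f phi.

Definition weak_cvg (F_ : nat -> form) F : Prop :=
  forall phi, C_b phi -> F_ n phi @[n --> \oo] --> F phi.

Definition weak_subseq_cvg (F_ : nat -> form) F : Prop :=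
  exists2 s : nat -> nat, {homo s : m n / (m < n)%N} & weak_cvg (F_ \o s) F.

End Forms.
Arguments form : clear implicits.

(* Main.v *)
Require Import Defs.
From mathcomp Require Import lra.
Import Order.TTheory GRing.Theory Num.Theory.
Import numFieldNormedType.Exports.

Set Implicit Arguments.
Unset Strict Implicit.
Unset Printing Implicit Defensive.

Local Open Scope classical_set_scope.
Local Open Scope ring_scope.
Local Open Scope ereal_scope.

(** The forms F_n behave like rescaled log-Laplace functionals of probability
    measures, and the proof is that of a large deviation principle.

    Upper bounds. Say that chi is asymptotically below l when some continuous
    majorant psi of chi satisfies F_n psi <= m < l for all large n (asymp_lt).
    As rho (F_n) tends to 0, this property is stable under finite maxima
    (asymp_lt_max), hence it passes from a neighbourhood of each point to a
    compact set (asymp_lt_compact). Strong coercivity at a point x of idom g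
    makes b x asymptotically below any l outside some compact set
    (kernel_tail); applied to x0, this is exponential tightness. If moreover a
    function f is such that small neighbourhoods of each y are asymptotically
    below every t > - f y (local_rate_bound), then every upper semicontinuous
    chi with chi - f < l pointwise, and which is asymptotically below l outside
    some compact set, is asymptotically below l (varadhan_upper_bound). Such an
    f is the conjugate B g, because b x shifted by a constant majorises the
    indicator of a neighbourhood of y (conjugate_local_rate_bound), and also the
    l.s.c. density of any weak limit (density_local_rate_bound). With f = B g
    and chi the indicator of a closed set this is the upper bound in (iii).

    Compactness. A separable metric space carries a countable family of
    continuous cut-offs that localises at every point (countable_bumps). Along a
    diagonal subsequence the forms converge on this family, and tightness
    extends the convergence to all of C_b, the limit being the max-plus linear
    form with the density rate (weak_relative_compactness). This gives (i).

    Identification. Let f be the density of a weak limit along a subsequence.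
    Passing to the limit in F_n (min (b x) r) <= F_n (b x) gives B g <= f
    (conjugate_le_density). If x is in idom g, then b(x, y) - f y cannot be
    below g x for all y, since g x is the limit of F_n (b x)
    (kernel_attained). A point y where it is at least g x satisfies
    f y <= b(x, y) - g x <= B g y <= f y, so that y is a subgradient of g at x
    and f y = B g y (attained_subdifferential). Hence the subgradients lying in
    E = {f = B g} already cover idom g. This implies (ii); E contains the
    algebraically essential points, and meets every neighbourhood of a
    topologically essential one. If Y is discrete the two notions agree.
    Otherwise, on the relative interior of the set of topologically essential
    points, quasi-continuity of B g and lower semicontinuity of f turn density
    of E into equality (quasi_continuous_essential_eq). So f = B g on Z, and
    testing the weak limits with cut-offs supported in G gives the lower bound
    in (iv). In (v), f is determined entirely, and all subsequential limits
    coincide. *)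

(** * Subsequences *)

Lemma frequently_subseq (P : nat -> nat -> Prop) :
  (forall k N, exists2 n, (N <= n)%N & P k n) ->
  exists2 s : nat -> nat, {homo s : m n / (m < n)%N} & forall k, P k (s k).
Proof.
move=> hP.
have /choice[h hh] : forall kN : nat * nat,
    exists n, (kN.2 <= n)%N /\ P kN.1 n.
  by move=> [k N]; have [n ? ?] := hP k N; exists n.
pose s := fix s k := if k is k'.+1 then h (k, (s k').+1) else h (0, 0)%N.
exists s.
  apply: homo_ltn => [? ? ?|k]; first exact: ltn_trans.
  by have [] := hh (k.+1, (s k).+1).
by case=> [|k]; [have [] := hh (0, 0)%N | have [] := hh (k.+1, (s k).+1)].
Qed.

(** If P failed infinitely often, the indices of failure would form a
    subsequence on which P never holds. *)
Lemma near_infty_subseq (P : nat -> Prop) :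
  (forall s : nat -> nat, {homo s : m n / (m < n)%N} -> exists n, P (s n)) ->
  \forall n \near \oo, P n.
Proof.
move=> hP; apply: contrapT => nP.
have [|s s_incr nPs] := @frequently_subseq (fun _ n => ~ P n).
  move=> _ N; apply: contrapT => hN; apply: nP; exists N => // n /= Nn.
  by apply: contrapT => nPn; apply: hN; exists n.
by have [n] := hP s s_incr; exact: nPs.
Qed.

Lemma cvg_subseq_infty (s : nat -> nat) :
  {homo s : m n / (m < n)%N} -> s n @[n --> \oo] --> \oo.
Proof.
move=> s_incr A [N _ NA]; exists N => // n /= Nn; apply: NA => /=.
apply: leq_trans Nn _; elim: n => // n IH.
by apply: leq_ltn_trans IH _; exact: s_incr.
Qed.

(** * Convergence and compactness in the extended reals *)

(** The open rays bounded by real numbers form a subbase of the topology. *)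
Lemma cvg_ereal_lt_gt {R : realType} {T : Type} (F : set_system T)
    {FF : Filter F} (u : T -> \bar R) (l : \bar R) :
  (forall a : R, a%:E < l -> \forall t \near F, a%:E < u t) ->
  (forall a : R, l < a%:E -> \forall t \near F, u t < a%:E) ->
  u @ F --> l.
Proof.
case: l => [l||] hlt hgt A.
- move=> Al; have /nbhs_ballP[e /= e0 eA] : nbhs l [set r | A r%:E] := Al.
  have h1 : \forall t \near F, (l - e)%:E < u t.
    by apply: hlt; rewrite lte_fin ltrBlDr ltrDl.
  have h2 : \forall t \near F, u t < (l + e)%:E.
    by apply: hgt; rewrite lte_fin ltrDl.
  suff : \forall t \near F, A (u t) by [].
  near=> t.
  have : (l - e)%:E < u t by near: t.
  have : u t < (l + e)%:E by near: t.
  case: (u t) => [r||] //; rewrite !lte_fin => r1 r2.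
  by have := eA r; rewrite -ball_normE /= ltr_distlC r1 r2 => /(_ isT).
- move=> [M [_ MA]]; have := hlt M (ltry _).
  by apply: filterS => t; exact: MA.
- move=> [M [_ MA]]; have := hgt M (ltNyr _).
  by apply: filterS => t; exact: MA.
Unshelve. all: by end_near. Qed.

Lemma lt_expand_contract {R : realType} (a : R) (t : R) :
  (a%:E < expand t) = (contract a%:E < t)%R.
Proof.
apply/idP/idP.
  by apply: contraTlt => /le_expand; rewrite contractK -leNgt.
move=> at_; have [t1|t1] := leP t 1%R; last by rewrite expand1 ?ltry// ltW.
rewrite -[X in X < _]contractK lt_expand ?inE ?contract_le1//.
rewrite ler_norml t1 andbT ltW// (le_lt_trans _ at_)//.
by have := contract_le1 a%:E; rewrite ler_norml => /andP[].
Qed.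

Lemma expand_continuous {R : realType} : continuous (@expand R).
Proof.
move=> x; apply: cvg_ereal_lt_gt => a.
  rewrite lt_expand_contract => ax; near=> t; rewrite lt_expand_contract.
  by near: t; exact: (lt_nbhsr ax).
rewrite -[x in expand x]opprK expandN lteNl -EFinN lt_expand_contract => ax.
near=> t; rewrite -[t]opprK expandN lteNl -EFinN lt_expand_contract.
by rewrite ltrNr; near: t; apply: lt_nbhsl; rewrite ltrNr.
Unshelve. all: by end_near. Qed.

Lemma ereal_compact {R : realType} : compact [set: \bar R].
Proof.
have -> : [set: \bar R] = @expand R @` `[(-1)%R, 1%R].
  apply/seteqP; split => // x _; exists (contract x); last exact: contractK.
  by rewrite /= in_itv /= -ler_norml contract_le1.
apply: continuous_compact; last exact: segment_compact.
by apply: continuous_subspaceT => x; exact: expand_continuous.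
Qed.

Lemma ereal_lt_approx {R : realType} (x : \bar R) (t : R) :
  x < t%:E -> exists2 s : R, (s < t)%R & x < s%:E.
Proof.
case: x => [x||]; rewrite ?lte_fin// => xt.
  by exists ((x + t) / 2)%R; rewrite ?lte_fin; lra.
by exists (t - 1)%R; [lra|exact: ltNyr].
Qed.

Lemma cvg_ereal_near_gt {R : realType} {T : Type} (F : set_system T)
    (u : T -> \bar R) (l a : \bar R) :
  u @ F --> l -> a < l -> \forall t \near F, a < u t.
Proof. by move=> ul al; exact: ul (open_ereal_gt' al). Qed.

Lemma cvg_ereal_near_lt {R : realType} {T : Type} (F : set_system T)
    (u : T -> \bar R) (l a : \bar R) :
  u @ F --> l -> l < a -> \forall t \near F, u t < a.
Proof. by move=> ul al; exact: ul (open_ereal_lt' al). Qed.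

Lemma cvg_ereal_le {R : realType} (u : nat -> \bar R) (l m : \bar R) :
  u n @[n --> \oo] --> l -> (\forall n \near \oo, u n <= m) -> l <= m.
Proof.
move=> ul um; rewrite leNgt; apply/negP => /(cvg_ereal_near_gt ul) mu.
near \oo => n; have : u n <= m by near: n.
by rewrite leNgt => /negP; apply; near: n.
Unshelve. all: by end_near. Qed.

Lemma ereal_le_real_gt {R : realType} (x y : \bar R) :
  (forall r : R, y < r%:E -> x <= r%:E) -> x <= y.
Proof.
case: y => [y||] h; last 2 first.
- exact: leey.
- case: x h => [x||] // h; last by have := h 0%R (ltNyr _).
  by have := h (x - 1)%R (ltNyr _); rewrite lee_fin lerBrDl gerDr ler10.
by apply/lee_addgt0Pr => e e0; apply: h; rewrite lte_fin ltrDl.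
Qed.

Lemma limn_esup_le {R : realType} (u : nat -> \bar R) (l : \bar R) :
  (forall r : R, l < r%:E -> \forall n \near \oo, u n <= r%:E) ->
  limn_esup u <= l.
Proof.
move=> h; apply: ereal_le_real_gt => r /h hr.
apply: (@le_trans _ _ (ereal_sup (u @` [set n | u n <= r%:E]))).
  by apply: ereal_inf_lbound; exists [set n | u n <= r%:E].
by apply: ge_ereal_sup => _ [n + <-].
Qed.

Lemma limn_einf_ge {R : realType} (u : nat -> \bar R) (l : \bar R) :
  (forall r : R, r%:E < l -> \forall n \near \oo, r%:E <= u n) ->
  l <= limn_einf u.
Proof.
move=> h; rewrite leeNr; apply: limn_esup_le => r lr.
have : \forall n \near \oo, (- r)%:E <= u n.
  by apply: h; rewrite EFinN lteNl.
by apply: filterS => n; rewrite EFinN leeNl.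
Qed.

(** The product of countably many copies of the extended real line is compact,
    so the sequence has a cluster point; as that product has countable bases
    of neighbourhoods, a subsequence converges to it. *)
Lemma diagonal_subsequence {R : realType} (u : nat -> nat -> \bar R) :
  exists2 s : nat -> nat, {homo s : m n / (m < n)%N} &
    exists c : nat -> \bar R, forall i, u (s n) i @[n --> \oo] --> c i.
Proof.
have := @tychonoff nat (fun _ => \bar R) (fun _ => setT)
  (fun _ => @ereal_compact R).
move=> /(_ (u @ \oo) _)[|c [_ cl_c]]; first by exists 0%N.
pose c' : prod_topology (fun _ : nat => \bar R) := c.
have near_c k e : (0 < e)%R ->
    nbhs c' [set f | forall i, (i < k)%N -> ball (c i) e (f i)].
  move=> e0; elim: k => [|k IH].
    exact: (@filterE _ _ (nbhs_filter c')).
  have /(_ (ball (c k) e)) := @proj_continuous nat (fun _ => \bar R) k c.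
  move=> /(_ (nbhsx_ballx _ _ e0)) ck.
  apply: (@filterS2 _ _ (nbhs_filter c') _ _ _ _ IH ck) => f fIH fk i.
  rewrite ltnS leq_eqVlt => /orP[/eqP->//|].
  exact: fIH.
have [|s s_incr hs] := @frequently_subseq (fun k n =>
    forall i, (i < k)%N -> ball (c i) k.+1%:R^-1 (u n i)).
  move=> k N.
  have tailN : (u @ \oo) (u @` [set n | (N <= n)%N]).
    by exists N => // n /= Nn; exists n.
  have k0 : (0 < k.+1%:R^-1 :> R)%R by rewrite invr_gt0.
  by have [_ [[n Nn <-] hn]] := cl_c _ _ tailN (near_c k _ k0); exists n.
exists s => //; exists c => i; apply/cvg_ballP => e e0.
near=> n; apply: (@le_ball _ _ _ n.+1%:R^-1); last first.
  by apply: hs; near: n; exact: nbhs_infty_gt.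
apply: ltW; near: n; exact: @near_infty_natSinv_lt R (PosNum e0).
Unshelve. all: by end_near. Qed.

(** * Cut-off functions on a metric space *)

(** A countable substitute for the indicators, in the max-plus sense, of the
    neighbourhoods of the points. *)
Definition localizing {R : realType} {Y : topologicalType}
    (phi : nat -> Y -> \bar R) : Prop :=
  (forall i, C_b (phi i) /\ forall y, phi i y <= 0) /\
  forall (y : Y) (U : set Y), nbhs y U ->
    exists2 i, nbhs y [set z | phi i z = 0] & forall z, ~ U z -> phi i z = -oo.

Section Bumps.
Context {R : realType} {Y : topologicalType} (d : Y -> Y -> R).
Hypotheses (d_metric : is_metric d) (d_top : metric_induces_topology d).

(** The max-plus analogue of a plateau function: it is 0 within distance r of
    c and -oo from distance 2 r on. *)
Definition bump (c : Y) (r : R) (y : Y) : \bar R :=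
  expand (Num.min 0 (1 - d c y / r))%R.

Lemma dist_continuous (c : Y) : continuous (d c).
Proof.
have [d0 deq dsym dtri] := d_metric.
move=> y; apply/cvgrPdist_lt => e e0.
have : nbhs y [set z | (d y z < e)%R] by rewrite d_top; exists e.
apply: filterS => z /= yz; rewrite ltr_distlC.
have := dtri c y z; have := dtri c z y; rewrite (dsym z y).
move: yz; lra.
Qed.

Lemma bump_le0 (c : Y) (r : R) (y : Y) : bump c r y <= 0.
Proof.
by rewrite -[X in _ <= X]expand0; apply: le_expand; rewrite ge_min lexx.
Qed.

Lemma C_b_bump (c : Y) (r : R) : C_b (bump c r).
Proof.
split; last by exists 0%R => y; exact: bump_le0.
pose h z : R := (Num.min 0 (1 - d c z / r))%R.
move=> y; suff : {for y, continuous (@expand R \o h)} by [].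
apply: continuous_comp; last exact: expand_continuous.
apply: continuous_min; first exact: cvg_cst.
apply: cvgB; first exact: cvg_cst.
by apply: cvgM; [exact: dist_continuous|exact: cvg_cst].
Qed.

Lemma bump_in (c : Y) (r : R) (y : Y) :
  (0 < r)%R -> (d c y < r)%R -> bump c r y = 0.
Proof.
move=> r0 cy; rewrite /bump min_l ?expand0// subr_ge0 ler_pdivrMr// mul1r.
exact: ltW.
Qed.

Lemma bump_out (c : Y) (r : R) (y : Y) :
  (0 < r)%R -> (2 * r <= d c y)%R -> bump c r y = -oo.
Proof.
move=> r0 cy; rewrite /bump expandN1// ge_min; apply/orP; right.
by rewrite lerBlDr -lerBlDl opprK ler_pdivlMr.
Qed.

(** Discretising the centres to a dense set and the radii to inverses of
    integers leaves countably many bumps, which still localise at any point. *)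
Lemma countable_bumps :
  separable Y -> exists phi : nat -> Y -> \bar R, localizing phi.
Proof.
have [d0 deq dsym dtri] := d_metric.
move=> [D cD dD].
pose B := [set bump ck.1 ck.2.+1%:R^-1 | ck in D `*` [set: nat]].
have cB : countable B.
  exact: (sub_countable (card_image_le _ _) (countableX cD (countableP _))).
have localise (y : Y) (U : set Y) : nbhs y U -> exists2 ph, B ph &
    nbhs y [set z | ph z = 0] /\ forall z, ~ U z -> ph z = -oo.
  rewrite {1}d_top => -[e /= e0 eU].
  have [k ke] : exists k : nat, (k.+1%:R^-1 < e / 3)%R.
    have e3 : (0 < e / 3)%R by rewrite divr_gt0.
    have [k _ /(_ k (leqnn _)) ke] := @near_infty_natSinv_lt R (PosNum e3).
    by exists k.
  set r := (k.+1%:R^-1)%R in ke; have r0 : (0 < r)%R by rewrite invr_gt0.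
  have yr : nbhs y [set z | (d y z < r)%R] by rewrite d_top; exists r.
  have [c [Dc ycr]] : D `&` [set z | (d y z < r)%R] !=set0.
    have [||c [/interior_subset ? ?]] := dD (interior [set z | (d y z < r)%R]).
    - by exists y.
    - exact: open_interior.
    - by exists c.
  exists (bump c r); first by exists (c, k).
  split.
    have cyr : (d c y < r)%R by rewrite dsym.
    have ycr' : nbhs y [set z | (d c z < r)%R].
      exact: (@dist_continuous c y) (lt_nbhsl cyr).
    by apply: filterS ycr' => z /= czr; exact: bump_in.
  move=> z nUz; apply: bump_out => //; rewrite leNgt; apply/negP => czr.
  apply: nUz; apply: eU => /=; rewrite (le_lt_trans (dtri y c z))//.
  move: ycr czr ke => /=; lra.
have [B0|] := pselect (B = set0).
  exists (fun _ _ => -oo); split.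
    move=> _; split; last by move=> y; exact: leNye.
    split; first by move=> y; exact: cvg_cst.
    by exists 0%R => y; exact: leNye.
  move=> y U /localise[ph]; by rewrite B0.
move: cB; rewrite /countable => /pfcard_geP[//|[phi]] nB0.
exists phi; split.
  move=> i; have [[c k] _ <-] : B (phi i) by exact: funS.
  by split; [exact: C_b_bump|exact: bump_le0].
move=> y U /localise[ph Bph [ph1 ph2]].
have [i _ phE] : (phi @` setT) ph by rewrite image_eq.
by exists i; rewrite phE.
Qed.

End Bumps.

(** * Extension of a form beyond C_b *)

Section Extension.
Context {R : realType} {Y : topologicalType}.
Implicit Types (F : form R Y) (phi psi chi : Y -> \bar R).

Lemma continuous_lsc phi : continuous phi -> lower_semicontinuous phi.
Proof.
move=> phi_cont y a ay; exists [set z | a%:E < phi z] => //.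
exact: (phi_cont y) (open_ereal_gt' ay).
Qed.

Lemma shift_continuous (a : R) phi :
  continuous phi -> continuous (fun y => a%:E + phi y).
Proof.
move=> phi_cont y; apply: cvg_ereal_lt_gt => c.
  rewrite -lteBlDl// => cy; near=> z; rewrite -lteBlDl//.
  near: z; exact: (phi_cont y) (open_ereal_gt' cy).
rewrite -lteBrDl// => cy; near=> z; rewrite -lteBrDl//.
near: z; exact: (phi_cont y) (open_ereal_lt' cy).
Unshelve. all: by end_near. Qed.

Lemma C_b_shift (a : R) phi : C_b phi -> C_b (fun y => a%:E + phi y).
Proof.
move=> [phi_cont [M phiM]]; split; first exact: shift_continuous.
by exists (a + M)%R => y; rewrite EFinD leeD2l.
Qed.

Lemma C_b_min phi (M : R) :
  continuous phi -> C_b (fun y => mine (phi y) M%:E).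
Proof.
move=> phi_cont; split; last by exists M => y; rewrite ge_min lexx orbT.
exact: min_fun_continuous phi_cont (fun=> cvg_cst _).
Qed.

Lemma le_ext_lsc F phi psi :
  (forall y, phi y <= psi y) -> ext_lsc F phi <= ext_lsc F psi.
Proof.
move=> phipsi; apply: le_ereal_sup => _ [chi [chiC chiphi] <-].
by exists chi => //; split => // y; exact: le_trans (chiphi y) (phipsi y).
Qed.

Lemma ext_lsc_le_ext F phi : ext_lsc F phi <= ext F phi.
Proof.
apply: le_ereal_inf_tmp => _ [psi [_ phipsi] <-]; exact: le_ext_lsc.
Qed.

Lemma ext_le_ext_lsc F phi psi :
  lsc psi -> (forall y, phi y <= psi y) -> ext F phi <= ext_lsc F psi.
Proof. by move=> ? ?; apply: ereal_inf_lbound; exists psi. Qed.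

Lemma le_ext F phi psi : C_b phi -> (forall y, phi y <= psi y) ->
  F phi <= ext F psi.
Proof.
move=> phiC phipsi; apply: le_trans (ext_lsc_le_ext F psi).
by apply: ereal_sup_ubound; exists phi.
Qed.

Lemma ext_lsc_le F phi : isotone F -> C_b phi -> ext_lsc F phi <= F phi.
Proof.
by move=> Fi phiC; apply: ge_ereal_sup => _ [psi [? ?] <-]; exact: Fi.
Qed.

Lemma ext_lsc_shift F (a : R) phi : additively_homogeneous F ->
  ext_lsc F (fun y => a%:E + phi y) <= a%:E + ext_lsc F phi.
Proof.
move=> Fh; apply: ge_ereal_sup => _ [chi [chiC chiphi] <-].
have chiC' : C_b (fun y => (- a)%:E + chi y) by exact: C_b_shift.
have -> : F chi = a%:E + F (fun y => (- a)%:E + chi y).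
  by rewrite Fh ?ltry// EFinN addeA subee// add0e.
rewrite leeD2l//; apply: ereal_sup_ubound; eexists; last by [].
by split => // y; rewrite EFinN addeC leeBlDl.
Qed.

(** A test function is bounded above, so the two unbounded functions may be
    truncated at its bound and replaced by elements of C_b. *)
Lemma ext_lsc_max F (a : R) phi psi : isotone F -> quasi_additive F a%:E ->
  continuous phi -> continuous psi ->
  ext_lsc F (fun y => maxe (phi y) (psi y)) <=
  a%:E + maxe (ext_lsc F phi) (ext_lsc F psi).
Proof.
move=> Fi Fa phi_cont psi_cont.
apply: ge_ereal_sup => _ [chi [chiC chile] <-].
have [_ [M chiM]] := chiC.
have phiC := C_b_min M phi_cont; have psiC := C_b_min M psi_cont.
apply: (@le_trans _ _
    (F (fun y => maxe (mine (phi y) M%:E) (mine (psi y) M%:E)))).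
  apply: Fi => //; last by move=> y; rewrite -min_maxl le_min chile chiM.
  split; last by exists M => y; rewrite ge_max !ge_min lexx !orbT.
  exact: max_fun_continuous phiC.1 psiC.1.
apply: le_trans (Fa _ _ phiC psiC) _; rewrite leeD2l// ge_max !le_max.
apply/andP; split; apply/orP; [left|right]; apply: ereal_sup_ubound;
  by eexists; last by []; split => // y; rewrite ge_min lexx.
Qed.

Lemma ext_lsc_Ny F : additively_homogeneous F ->
  ext_lsc F (fun=> -oo) = -oo.
Proof.
move=> Fh; apply/eqP; rewrite -leeNy_eq.
apply: ge_ereal_sup => _ [chi [chiC chiNy] <-].
have -> : chi = (fun y => -oo + chi y).
  by apply/funext => y; rewrite addNye; apply/eqP; rewrite -leeNy_eq.
by rewrite Fh.
Qed.

Lemma rho_quasi_additive F (e : R) :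
  rho F < e%:E -> quasi_additive F e%:E.
Proof.
move=> /ereal_inf_lt[a [_ Fa] ae] phi psi phiC psiC.
by apply: le_trans (Fa _ _ phiC psiC) _; rewrite leeD2r// ltW.
Qed.

End Extension.

(** * Asymptotic upper bounds along a sequence of forms *)

Section AsymptoticBounds.
Context {R : realType} {Y : topologicalType}.
Implicit Types (phi psi chi f : Y -> \bar R).

Definition asymptotically_linear (F_ : nat -> form R Y) : Prop :=
  (forall n, isotone (F_ n) /\ additively_homogeneous (F_ n)) /\
  (forall e : R, (0 < e)%R -> \forall n \near \oo, quasi_additive (F_ n) e%:E).

Lemma asymptotically_linear_subseq F_ (s : nat -> nat) :
  asymptotically_linear F_ -> {homo s : m n / (m < n)%N} ->
  asymptotically_linear (F_ \o s).
Proof.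
move=> [F_lin F_qa] s_incr; split => [n|e e0]; first exact: F_lin.
exact: (cvg_subseq_infty s_incr) (F_qa e e0).
Qed.

(** Bounding the limsup of the forms at a continuous majorant of chi, rather
    than at chi, makes the bound stable under finite maxima without any
    regularity of chi. *)
Definition asymp_lt (F_ : nat -> form R Y) (l : R) chi : Prop :=
  exists psi, [/\ continuous psi, forall y, psi y < +oo,
    forall y, chi y <= psi y &
    exists2 m : R, (m < l)%R & \forall n \near \oo, ext_lsc (F_ n) psi <= m%:E].

Lemma asymp_lt_subseq F_ (s : nat -> nat) (l : R) chi :
  {homo s : m n / (m < n)%N} -> asymp_lt F_ l chi -> asymp_lt (F_ \o s) l chi.
Proof.
move=> s_incr [psi [? ? ? [m ml hm]]]; exists psi; split => //; exists m => //.
exact: (cvg_subseq_infty s_incr) hm.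
Qed.

Definition restr (A : set Y) chi (y : Y) : \bar R :=
  if y \in A then chi y else -oo.

Variables (F_ : nat -> form R Y) (F_lin : asymptotically_linear F_).

Lemma le_asymp_lt (l : R) phi chi :
  (forall y, phi y <= chi y) -> asymp_lt F_ l chi -> asymp_lt F_ l phi.
Proof.
move=> phichi [psi [psi_cont psiy chipsi hm]]; exists psi; split => // y.
exact: le_trans (phichi y) (chipsi y).
Qed.

Lemma asymp_lt_open (l : R) chi :
  asymp_lt F_ l chi -> exists2 l' : R, (l' < l)%R & asymp_lt F_ l' chi.
Proof.
move=> [psi [psi_cont psiy chipsi [m ml hm]]]; exists ((m + l) / 2)%R; first lra.
by exists psi; split => //; exists m => //; lra.
Qed.

Lemma asymp_lt_Ny (l : R) : asymp_lt F_ l (fun=> -oo).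
Proof.
exists (fun=> -oo); split => //; first by move=> y; exact: cvg_cst.
exists (l - 1)%R; first lra.
by apply: nearW => n; rewrite ext_lsc_Ny ?leNye//; exact: (F_lin.1 n).2.
Qed.

Lemma asymp_lt_max (l : R) phi chi : asymp_lt F_ l phi -> asymp_lt F_ l chi ->
  asymp_lt F_ l (fun y => maxe (phi y) (chi y)).
Proof.
move=> [p [p_cont py phip [m ml hm]]] [q [q_cont qy chiq [k kl hk]]].
exists (fun y => maxe (p y) (q y)); split.
- exact: max_fun_continuous p_cont q_cont.
- by move=> y; rewrite gt_max py qy.
- by move=> y; rewrite ge_max !le_max phip chiq orbT.
pose M := Num.max m k; have Ml : (M < l)%R by rewrite gt_max ml kl.
exists ((M + l) / 2)%R; first lra.
have e0 : (0 < (l - M) / 2)%R by lra.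
near=> n.
apply: (@le_trans _ _ (((l - M) / 2)%:E +
    maxe (ext_lsc (F_ n) p) (ext_lsc (F_ n) q))).
  apply: ext_lsc_max => //; first exact: (F_lin.1 n).1.
  by near: n; exact: (F_lin.2 _ e0).
apply: (@le_trans _ _ (((l - M) / 2)%:E + M%:E)); last first.
  by rewrite -EFinD lee_fin; lra.
rewrite leeD2l// EFin_max ge_max !le_max; apply/andP; split; apply/orP.
  by left; near: n.
by right; near: n.
Unshelve. all: by end_near. Qed.

Lemma asymp_lt_shift (a l : R) chi :
  asymp_lt F_ (l - a) chi -> asymp_lt F_ l (fun y => a%:E + chi y).
Proof.
move=> [p [p_cont py chip [m ml hm]]].
exists (fun y => a%:E + p y); split.
- exact: shift_continuous.
- by move=> y; rewrite lte_add_pinfty// ltry.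
- by move=> y; rewrite leeD2l.
exists (a + m)%R; first lra.
apply: filterS hm => n hm; apply: le_trans (ext_lsc_shift _ _ (F_lin.1 n).2) _.
by rewrite EFinD leeD2l.
Qed.

Lemma asymp_lt_C_b (l : R) (c : \bar R) phi : C_b phi ->
  F_ n phi @[n --> \oo] --> c -> c < l%:E -> asymp_lt F_ l phi.
Proof.
move=> phiC phi_c cl; have [phi_cont [M phiM]] := phiC.
have [m ml cm] := ereal_lt_approx cl.
exists phi; split => //; first by move=> y; rewrite (le_lt_trans (phiM y))// ltry.
exists m => //; near=> n.
apply: le_trans (ext_lsc_le (F_lin.1 n).1 phiC) _; apply: ltW.
near: n; exact: cvg_ereal_near_lt phi_c cm.
Unshelve. all: by end_near. Qed.

Lemma asymp_lt_ext (l : R) chi : asymp_lt F_ l chi ->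
  exists2 m : R, (m < l)%R & \forall n \near \oo, ext (F_ n) chi <= m%:E.
Proof.
move=> [p [p_cont py chip [m ml hm]]]; exists m => //.
apply: filterS hm => n; apply: le_trans; apply: ext_le_ext_lsc => //.
by split => //; exact: continuous_lsc.
Qed.

Lemma asymp_lt_finite {I : eqType} (D : set I) (psi : I -> Y -> \bar R) (l : R)
    chi :
  finite_set D -> (forall i, D i -> asymp_lt F_ l (psi i)) ->
  (forall y, chi y = -oo \/ exists2 i, D i & chi y <= psi i y) ->
  asymp_lt F_ l chi.
Proof.
move=> /finite_seqP[s ->]; elim: s chi => [|i s IH] chi psi_lt chi_le.
  by apply: le_asymp_lt (asymp_lt_Ny l) => y; case: (chi_le y) => [->|[]].
pose A := [set y | chi y <= psi i y].
apply: (@le_asymp_lt _ _ (fun y => maxe (psi i y) (restr (~` A) chi y))).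
  move=> y; rewrite /restr le_max; case: ifPn; first by rewrite lexx orbT.
  by rewrite in_setC negbK inE => ->.
apply: asymp_lt_max; first by apply: psi_lt; rewrite /= mem_head.
apply: IH => [j js|y]; first by apply: psi_lt; rewrite /= inE js orbT.
rewrite /restr; case: ifPn => [|_]; last by left.
rewrite in_setC notin_setE => nA; case: (chi_le y) => [|[j + jy]]; first by left.
by rewrite /= inE => /orP[/eqP ji|js]; [rewrite ji in jy|right; exists j].
Qed.

(** The sets on which chi is asymptotically below l form an ideal; if a compact
    set were not in it, the complements would have a cluster point in it, where
    the local bound fails. *)
Lemma asymp_lt_compact (K : set Y) (l : R) chi : compact K ->
  (forall y, K y -> exists2 U, nbhs y U & asymp_lt F_ l (restr U chi)) ->
  asymp_lt F_ l (restr K chi).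
Proof.
move=> Kc Kloc; apply: contrapT => nK.
pose G := [set A : set Y | asymp_lt F_ l (restr (K `\` A) chi)].
have GF : Filter G.
  split.
  - rewrite /G /= setDT; apply: le_asymp_lt (asymp_lt_Ny l) => y.
    by rewrite /restr in_set0.
  - move=> A B GA GB; apply: le_asymp_lt (asymp_lt_max GA GB) => y.
    rewrite /restr; case: ifPn; last by move=> _; exact: leNye.
    rewrite inE => -[Ky nAB]; rewrite le_max.
    have [Ay|nAy] := pselect (A y); apply/orP; [right|left].
      by rewrite ifT// inE; split => // By; exact: nAB.
    by rewrite ifT// inE.
  - move=> A B AB; apply: le_asymp_lt => y; rewrite /restr.
    case: ifPn => [|_]; last exact: leNye.
    by rewrite inE => -[Ky nB]; rewrite ifT// inE; split => // /AB.
have GP : ProperFilter G.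
  apply: Build_ProperFilter_ex => // A GA; apply: contrapT => nA; apply: nK.
  apply: le_asymp_lt GA => y; rewrite /restr.
  case: ifPn => [|_]; last exact: leNye.
  by rewrite inE => Ky; rewrite ifT// inE; split => // Ay; apply: nA; exists y.
have GK : G K.
  by rewrite /G /= setDv; apply: le_asymp_lt (asymp_lt_Ny l) => y;
    rewrite /restr in_set0.
have [y [Ky cly]] := Kc G GP GK.
have [U yU Ult] := Kloc y Ky.
have GU : G (~` U).
  apply: le_asymp_lt Ult => z; rewrite /restr.
  case: ifPn => [|_]; last exact: leNye.
  by rewrite inE => -[Kz /contrapT Uz]; rewrite ifT// inE.
by have [z [nUz /nUz]] := cly _ _ GU yU.
Qed.

(** The forms applied to small neighbourhoods of y are asymptotically at most
    - f y; this is the local half of a large deviation upper bound. *)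
Definition local_rate_bound f : Prop :=
  forall y (t : R), - f y < t%:E ->
    exists2 U, nbhs y U & asymp_lt F_ t (indic_max U).

(** The upper half of Varadhan's lemma, with the exponential tail bound as a
    hypothesis. Near y the function is below a constant s close to its value
    at y, and the forms give about - f y to a small neighbourhood. *)
Lemma varadhan_upper_bound f chi (l : R) (K : set Y) :
  local_rate_bound f -> (exists T : R, asymp_lt F_ T (fun=> 0)) ->
  (forall y, chi y < +oo) ->
  (forall y (s : R), chi y < s%:E -> \forall z \near y, chi z < s%:E) ->
  compact K -> asymp_lt F_ l (restr (~` K) chi) ->
  (forall y, chi y - f y < l%:E) ->
  asymp_lt F_ l chi.
Proof.
move=> hf [T hT] chiy chi_usc Kc Ktail chif.
have Klt : asymp_lt F_ l (restr K chi).
  apply: asymp_lt_compact => // y _.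
  (* If chi y = -oo, the constant is so negative that the global bound T
     suffices, whatever the value of f y, which may then be -oo. *)
  have [chiNy|chi_fin] : chi y = -oo \/ exists r : R, chi y = r%:E.
  - by have := chiy y; case: (chi y) => [r||] // _; [right; exists r|left].
  - have yU := chi_usc y (l - T)%R; rewrite chiNy in yU.
    exists [set z | chi z < (l - T)%:E]; first exact: yU (ltNyr _).
    apply: (@le_asymp_lt _ _ (fun y => (l - T)%:E + 0)).
      move=> z; rewrite /restr; case: ifPn => [|_]; last exact: leNye.
      by rewrite inE adde0 => /ltW.
    by apply: asymp_lt_shift; rewrite opprB addrC subrK.
  have [r yr] := chi_fin.
  have fy : - f y < (l - r)%:E.
    by have := chif y; rewrite yr EFinB lteBrDl.
  have [U yU /asymp_lt_open[t' t'l Ut']] := hf y _ fy.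
  have ys : chi y < (l - t')%:E by rewrite yr lte_fin; lra.
  exists (U `&` [set z | chi z < (l - t')%:E]).
    by apply: filterI => //; exact: chi_usc.
  apply: (@le_asymp_lt _ _ (fun y => (l - t')%:E + indic_max U y)).
    move=> z; rewrite /restr; case: ifPn => [|_]; last exact: leNye.
    rewrite inE => -[Uz /ltW zs]; rewrite /indic_max ifT ?adde0//.
    by rewrite inE.
  by apply: asymp_lt_shift; rewrite opprB addrC subrK.
apply: le_asymp_lt (asymp_lt_max Klt Ktail) => y.
rewrite le_max /restr in_setC; case: ifPn => _ /=.
  by rewrite lexx.
by rewrite lexx orbT.
Qed.

End AsymptoticBounds.

(** * Forms given by a density *)

Section Density.
Context {R : realType} {Y : topologicalType}.
Implicit Types (f phi chi : Y -> \bar R).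

Lemma density_le f phi (l : \bar R) :
  (forall y, phi y - f y <= l) -> form_of_density f phi <= l.
Proof. by move=> h; apply: ge_ereal_sup => _ [y _ <-]. Qed.

Lemma density_ge f phi (y : Y) : phi y - f y <= form_of_density f phi.
Proof. by apply: ereal_sup_ubound; exists y. Qed.

Lemma density_isotone f : isotone (form_of_density f).
Proof.
move=> phi psi _ _ phipsi; apply: density_le => y.
by apply: le_trans (density_ge f psi y); rewrite leeD2r.
Qed.

Lemma density_homogeneous f : additively_homogeneous (form_of_density f).
Proof.
move=> [a||] phi // _ phiC.
  apply/eqP; rewrite eq_le; apply/andP; split.
    by apply: density_le => y; rewrite -addeA leeD2l// density_ge.
  rewrite -leeBrDl//; apply: density_le => y; rewrite leeBrDl// addeA.
  exact: (density_ge f (fun y => a%:E + phi y)).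
rewrite addNye; apply/eqP; rewrite -leeNy_eq; apply: density_le => y.
by rewrite !addNye.
Qed.

Lemma density_quasi_additive f : quasi_additive (form_of_density f) 0.
Proof.
move=> phi psi _ _; rewrite add0e; apply: density_le => y.
rewrite le_max; have [_|_] := leP (phi y) (psi y).
  by rewrite density_ge orbT.
by rewrite density_ge.
Qed.

Lemma density_continuous f : (forall y, -oo < f y) ->
  continuous_form (form_of_density f).
Proof.
move=> fNy phi_ phi phi_C phiC phi_nd phi_cvg; apply: cvg_ereal_lt_gt => a.
  move=> /ereal_sup_gt[_ [y _ <-]] ay.
  have [r fr] : exists r : R, f y = r%:E.
    move: (fNy y) ay; case: (f y) => [r||] //; first by exists r.
    by rewrite addeNy.
  rewrite fr lteBrDr// -EFinD in ay.
  apply: filterS (cvg_ereal_near_gt (phi_cvg y) ay) => k ak.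
  apply: lt_le_trans (density_ge f (phi_ k) y).
  by rewrite fr lteBrDr// -EFinD.
move=> fa; apply: nearW => k; apply: le_lt_trans fa.
apply: density_isotone => // y.
rewrite leNgt; apply/negP => /(cvg_ereal_near_lt (phi_cvg y)) lt_phik.
near \oo => n; have : phi_ n y < phi_ k y by near: n.
rewrite ltNge (phi_nd y)//; near: n; exact: nbhs_infty_ge.
Unshelve. all: by end_near. Qed.

Lemma density_maxplus_L f : (forall y, -oo < f y) ->
  (forall phi, C_b phi -> form_of_density f phi < +oo) ->
  maxplus_L (form_of_density f).
Proof.
move=> fNy ffin; split.
  split => //; last exact: density_continuous.
  split; [exact: density_isotone|exact: density_homogeneous|].
  by exists 0; [exact: ltry|exact: density_quasi_additive].
apply: ereal_inf_lbound; split; first exact: ltry.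
exact: density_quasi_additive.
Qed.

End Density.

(** * Construction of weak limits *)

Section WeakLimits.
Context {R : realType} {Y : topologicalType}.
Implicit Types (f phi chi : Y -> \bar R).

Variables (phi : nat -> Y -> \bar R) (phi_loc : localizing phi).
Variables (F_ : nat -> form R Y) (F_lin : asymptotically_linear F_).

(** If - f y < s < t then, by lower semicontinuity, some bump lives where
    - f < s. The limit of the forms at this bump is at most s, and the bump
    majorises the indicator of a neighbourhood of y. *)
Lemma density_local_rate_bound F f :
  weak_cvg F_ F -> is_lsc_density F f -> local_rate_bound F_ f.
Proof.
move=> F_F [f_lsc Ff] y t /ereal_lt_approx[s st].
rewrite lteNl -EFinN => /f_lsc[V yV Vf].
have [i yi Vi] := phi_loc.2 y V yV; have [iC i0] := phi_loc.1 i.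
exists [set z | phi i z = 0] => //.
apply: (@le_asymp_lt _ _ _ _ _ (phi i)).
  by move=> z; rewrite /indic_max; case: ifPn => [|_];
    [rewrite inE /= => ->|exact: leNye].
apply: (asymp_lt_C_b F_lin iC (F_F _ iC)).
rewrite Ff//; apply: (@le_lt_trans _ _ s%:E); last by rewrite lte_fin.
apply: density_le => z; have [/Vf zf|/Vi ->] := pselect (V z); last first.
  by rewrite addNye leNye.
rewrite -[s%:E]add0e; apply: leeD; first exact: i0.
by rewrite leeNl -EFinN ltW.
Qed.

Variables (c : nat -> \bar R).
Hypothesis phi_c : forall i, F_ n (phi i) @[n --> \oo] --> c i.

(** - rate y is the infimum of the limits over the bumps equal to 0 around y:
    the limiting exponential mass of arbitrarily small neighbourhoods of y. *)
Definition rate (y : Y) : \bar R :=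
  ereal_sup [set - c i | i in [set i | nbhs y [set z | phi i z = 0]]].

Lemma rate_ge y i : nbhs y [set z | phi i z = 0] -> - c i <= rate y.
Proof. by move=> yi; apply: ereal_sup_ubound; exists i. Qed.

Lemma rate_lsc : lower_semicontinuous rate.
Proof.
move=> y a /ereal_sup_gt[_ [i yi <-]] ai.
exists (interior [set z | phi i z = 0]); first exact: nbhs_interior.
by move=> z zi; exact: lt_le_trans ai (rate_ge zi).
Qed.

Lemma rate_local_rate_bound : local_rate_bound F_ rate.
Proof.
move=> y t; rewrite lteNl => /ereal_sup_gt[_ [i yi <-]].
rewrite lteN2 => cit; exists [set z | phi i z = 0] => //.
apply: (@le_asymp_lt _ _ _ _ _ (phi i)); last first.
  exact: (asymp_lt_C_b F_lin (phi_loc.1 i).1 (@phi_c i) cit).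
by move=> z; rewrite /indic_max; case: ifPn => [|_];
  [rewrite inE /= => ->|exact: leNye].
Qed.

Variable T : R.
Hypothesis F_T : asymp_lt F_ T (fun=> 0).

Lemma rate_bounded_below y : - rate y <= T%:E.
Proof.
have [i yi _] := phi_loc.2 y setT filterT.
apply: (@le_trans _ _ (c i)); first by rewrite leeNl; exact: rate_ge.
have [iC i0] := phi_loc.1 i.
have [m mT hm] := asymp_lt_ext F_T.
apply: cvg_ereal_le (@phi_c i) _; apply: filterS hm => n hn.
apply: le_trans (le_ext (F_ n) iC i0) (le_trans hn _).
by rewrite lee_fin ltW.
Qed.

Hypothesis F_tail : forall l : R,
  exists2 K, compact K & asymp_lt F_ l (indic_max (~` K)).

(** Lower half: near y, chi exceeds a constant close to chi y, hence it exceeds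
    that constant plus a bump around y, whose limit is at least - rate y. Upper
    half: chi is bounded above, so the bound for its tails is tightness. *)
Lemma weak_cvg_rate : weak_cvg F_ (form_of_density rate).
Proof.
move=> chi chiC; have [chi_cont [M chiM]] := chiC.
apply: cvg_ereal_lt_gt => a.
  move=> /ereal_sup_gt[_ [y _ <-]] ay.
  have [r yr] : exists r : R, chi y = r%:E.
    move: (le_lt_trans (chiM y) (ltry M)) ay.
    by case: (chi y) => [r||] //; exists r.
  have /ereal_lt_approx[s sr ys] : rate y < (r - a)%:E.
    by rewrite EFinB lteBrDr// -lte_suber_addl// -yr.
  have yU : nbhs y [set z | (a + s)%:E < chi z].
    by apply: (cvg_ereal_near_gt (chi_cont y)); rewrite yr lte_fin; lra.
  have [i yi Ui] := phi_loc.2 _ _ yU; have [iC i0] := phi_loc.1 i.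
  have sc : (- s)%:E < c i.
    by rewrite EFinN lteNl; exact: le_lt_trans (rate_ge yi) ys.
  apply: filterS (cvg_ereal_near_gt (@phi_c i) sc) => n hn.
  have := (F_lin.1 n).1 (fun y => (a + s)%:E + phi i y) chi.
  move=> /(_ (C_b_shift _ iC) chiC _); rewrite (F_lin.1 n).2 ?ltry// => hF.
  apply: lt_le_trans (hF _).
    by rewrite EFinD -addeA -lteBlDl// subee// -lteBlDl// sub0e -EFinN.
  move=> z; have [/= /ltW zU|/Ui ->] := pselect ([set z | (a + s)%:E < chi z] z).
    by apply: le_trans zU; rewrite -[leRHS]adde0 leeD2l.
  by rewrite addeNy leNye.
move=> fa; have [K Kc Ktail] := F_tail (a - M)%R.
have chi_lt : asymp_lt F_ a chi.
  apply: (varadhan_upper_bound F_lin rate_local_rate_bound _ _ _ Kc).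
  - by exists T.
  - by move=> y; rewrite (le_lt_trans (chiM y))// ltry.
  - by move=> y s ys; exact: cvg_ereal_near_lt (chi_cont y) ys.
  - apply: le_asymp_lt (asymp_lt_shift F_lin Ktail) => y.
    rewrite /restr /indic_max; case: ifPn => _; last exact: leNye.
    by rewrite adde0.
  - by move=> y; apply: le_lt_trans fa; exact: density_ge.
have [m ma hm] := asymp_lt_ext chi_lt.
apply: filterS hm => n hn; apply: le_lt_trans (le_ext (F_ n) chiC _) _ => //.
by apply: le_lt_trans hn _; rewrite lte_fin.
Qed.

Lemma maxplus_L_rate : maxplus_L (form_of_density rate).
Proof.
apply: density_maxplus_L => [y|chi [_ [M chiM]]].
  have := rate_bounded_below y; rewrite leeNl -EFinN; apply: lt_le_trans.
  exact: ltNyr.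
apply: (@le_lt_trans _ _ (M + T)%:E); last exact: ltry.
apply: density_le => y; rewrite EFinD; apply: leeD => //.
exact: rate_bounded_below.
Qed.

End WeakLimits.

(** * Limits along a kernel *)

Section Kernel.
Context {R : realType} {X Y : topologicalType} (b : X -> Y -> \bar R).
Variables (F_ : nat -> form R Y) (F_lin : asymptotically_linear F_).
Variables (g : X -> \bar R).
Hypotheses (b_fin : forall x y, b x y < +oo).
Hypotheses (b_cont : forall x, continuous (b x)).
Hypotheses (F_g : forall x, ext (F_ n) (b x) @[n --> \oo] --> g x).

Lemma asymp_lt_kernel x (l : R) : g x < l%:E -> asymp_lt F_ l (b x).
Proof.
move=> /ereal_lt_approx[m ml gm]; exists (b x); split => //.
exists m => //; apply: filterS (cvg_ereal_near_lt (@F_g x) gm) => n hn.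
by apply: le_trans (ext_lsc_le_ext _ _) _; exact: ltW.
Qed.

Lemma kernel_usc x y (s : R) :
  b x y < s%:E -> \forall z \near y, b x z < s%:E.
Proof. by move=> ys; exact: cvg_ereal_near_lt (@b_cont x y) ys. Qed.

(** If b x y - g x > - t, then b x, shifted by a constant slightly above
    - b x y, majorises the indicator of a neighbourhood of y, and the forms are
    asymptotically below t there. *)
Lemma conjugate_local_rate_bound : local_rate_bound F_ (conjugate b g).
Proof.
move=> y t; rewrite lteNl -EFinN => /ereal_sup_gt[_ [x _ <-]] xt.
have [r yr] : exists r : R, b x y = r%:E.
  move: (b_fin x y) xt; case: (b x y) => [r||] //; by exists r.
have gx : g x < (r + t)%:E.
  move: xt; rewrite yr; case: (g x) => [v||] //; last by rewrite ltNyr.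
  by rewrite -EFinB !lte_fin; lra.
have [s sl hs] := asymp_lt_open (asymp_lt_kernel gx).
exists [set z | (s - t)%:E < b x z].
  by apply: (cvg_ereal_near_gt (@b_cont x y)); rewrite yr lte_fin; lra.
apply: (@le_asymp_lt _ _ _ _ _ (fun z => (t - s)%:E + b x z)).
  move=> z; rewrite /indic_max; case: ifPn => [|_]; last exact: leNye.
  rewrite inE /= => /ltW zU; rewrite -leeBlDl// sub0e -EFinN.
  by apply: le_trans zU; rewrite lee_fin; lra.
by apply: asymp_lt_shift => //; rewrite opprB addrC subrK.
Qed.

(** Truncating b x at the level b x y gives an element of C_b with the same
    value at y, at which the weak limit is at most lim F_n (b x) = g x. *)
Lemma conjugate_le_density F f : weak_cvg F_ F -> is_lsc_density F f ->
  forall y, conjugate b g y <= f y.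
Proof.
move=> F_F [f_lsc Ff] y; apply: ge_ereal_sup => _ [x _ <-].
case yr : (b x y) (b_fin x y) => [r||] // _; last by rewrite addNye leNye.
have phiC := C_b_min r (@b_cont x).
suff : r%:E - f y <= g x.
  case: (g x) => [v||]; rewrite ?addeNy ?leNye//; case: (f y) => [w||] //=.
    by rewrite -!EFinB !lee_fin; lra.
  by rewrite leey.
apply: (@le_trans _ _ (F (fun y => mine (b x y) r%:E))).
  rewrite Ff//; apply: le_trans (density_ge _ _ y).
  by rewrite yr minxx.
rewrite -(cvg_lim (@ereal_hausdorff R) (F_F _ phiC)).
rewrite -(cvg_lim (@ereal_hausdorff R) (@F_g x)).
apply: lee_lim; [apply/cvg_ex; eexists; exact: F_F|
  apply/cvg_ex; eexists; exact: F_g|].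
by apply: nearW => n; apply: le_ext => // z; rewrite ge_min lexx.
Qed.

(** Outside a compact set, b x is dominated by the maximum of - beta + b w over
    finitely many points w of a neighbourhood of x on which g is bounded by a
    constant M. The forms at b w converge to g w, and beta is arbitrary,
    so that - beta + M < l can be achieved. *)
Lemma kernel_tail x (l : R) : strongly_coercive b -> idom g x ->
  exists2 K, compact K & asymp_lt F_ l (restr (~` K) (b x)).
Proof.
move=> b_coer [gx /ereal_inf_lt[_ [V xV <-] Vfin]].
have [M VM] : exists M : R, forall w, V w -> g w <= M%:E.
  have gV w : V w -> g w <= ereal_sup (g @` V).
    by move=> Vw; apply: ereal_sup_ubound; exists w.
  move: Vfin gV; case: (ereal_sup _) => [M||] // _ gV; first by exists M.
  by exists 0%R => w /gV; rewrite leeNy_eq => /eqP ->; exact: leNye.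
have [W [W_fin WV Wcpt]] := b_coer x V xV.
pose beta := (M - l + 1)%R.
exists (closure [set y | b_diff b x W y <= beta%:E]).
  by rewrite -precompactE.
apply: (@asymp_lt_finite _ _ _ F_lin X W (fun w y => (- beta)%:E + b w y)) => //.
  move=> w Ww; apply: asymp_lt_shift => //; apply: asymp_lt_kernel.
  by apply: (le_lt_trans (VM _ (WV _ Ww))); rewrite lte_fin /beta; lra.
move=> y; rewrite /restr; case: ifPn => [|_]; last by left.
rewrite inE => nKy.
have [[r yr]|yNy] : (exists r : R, b x y = r%:E) \/ b x y = -oo; last by left.
  by move: (b_fin x y); case: (b x y) => [r||] // _; [left; exists r|right].
have : beta%:E < b_diff b x W y.
  by rewrite ltNge; apply/negP => hy; apply: nKy; exact: subset_closure.
rewrite /b_diff yr lteBrDr// -EFinD => /ereal_sup_gt[_ [w Ww <-]] /ltW hw.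
right; exists w => //; rewrite -leeBlDl// EFinN oppeK addeC -EFinD //.
Qed.

(** Otherwise the upper half of Varadhan's lemma would put the limit g x of the
    forms at b x strictly below itself. *)
Lemma kernel_attained f x : local_rate_bound F_ f ->
  (exists T : R, asymp_lt F_ T (fun=> 0)) -> strongly_coercive b -> idom g x ->
  exists y, g x <= b x y - f y.
Proof.
move=> hf hT b_coer gx; have [/fineK gE _] := gx.
apply: contrapT => /forallNP hy.
have [K Kc Ktail] := kernel_tail (fine (g x)) b_coer gx.
have b_lt : asymp_lt F_ (fine (g x)) (b x).
  apply: (varadhan_upper_bound F_lin hf hT _ _ Kc Ktail) => y.
  - exact: b_fin.
  - exact: kernel_usc.
  - by rewrite gE ltNge; apply/negP/hy.
have [m mg hm] := asymp_lt_ext b_lt.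
have := cvg_ereal_le (@F_g x) hm.
by rewrite -gE lee_fin leNgt mg.
Qed.

(** The hypotheses give b(x', y) - g x' <= B g y <= f y <= b(x, y) - g x for all
    x', and the case x' = x turns the last two inequalities into equalities. *)
Lemma attained_subdifferential f x y : (forall z, conjugate b g z <= f z) ->
  g x \is a fin_num -> g x <= b x y - f y ->
  [/\ subdifferential b g x y, f y = conjugate b g y & f y < +oo].
Proof.
move=> fg gx gy.
have [r yr] : exists r : R, b x y = r%:E.
  move: (b_fin x y) gy; case: (b x y) => [r||] // _; first by exists r.
  by rewrite addNye leeNy_eq => /eqP gNy; rewrite gNy in gx.
have fy : f y <= b x y - g x.
  move: gx gy; rewrite yr; case: (g x) => [v||] // _.
  case: (f y) => [w||]; last by rewrite leNye.
    by rewrite -!EFinB !lee_fin; lra.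
  by rewrite addeNy leeNy_eq.
have gxy : b x y - g x <= conjugate b g y by apply: ereal_sup_ubound; exists x.
split.
- split; first by rewrite yr.
  move=> x'; apply: le_trans (le_trans (fg y) fy).
  by apply: ereal_sup_ubound; exists x'.
- by apply/eqP; rewrite eq_le fg (le_trans fy).
- apply: le_lt_trans fy _; rewrite yr; move: gx; case: (g x) => [v||] // _.
  by rewrite -EFinB ltry.
Qed.

End Kernel.

(** * Essential elements of a covering *)

Section Essential.
Context {T : topologicalType} {U : Type}.
Variables (Z : set T) (Phi : T -> set U) (W : set U) (E : set T).
Hypothesis E_covers : W `<=` \bigcup_(z in Z `&` E) Phi z.

Lemma algebraically_essential_mem y :
  algebraically_essential Z Phi W y -> E y.
Proof.
move=> [Zy ny]; apply: contrapT => nEy; apply: ny => x /E_covers[z [Zz Ez] xz].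
by exists z => //; split => // zy; rewrite zy in Ez.
Qed.

Lemma topologically_essential_near y V :
  topologically_essential Z Phi W y -> nbhs y V -> exists z, [/\ Z z, E z & V z].
Proof.
move=> [Zy ny] yV; apply: contrapT => nV; apply: (ny (interior V)).
  by split => //; apply: open_subspaceW; exact: open_interior.
move=> x /E_covers[z [Zz Ez] xz]; exists z => //; split => // /interior_subset Vz.
by apply: nV; exists z.
Qed.

Lemma topologically_essential_discrete : discrete_space T ->
  topologically_essential Z Phi W `<=` algebraically_essential Z Phi W.
Proof.
move=> T_discr y [Zy ny]; split => //; apply: ny; split => //.
by apply: open_subspaceW; exact: T_discr.
Qed.

End Essential.

(** Near a point of the relative interior of the topologically essential
    elements, h and f agree on a dense set. If h y < c < f y, quasi-continuity
    provides an open set close to y on which h < c, while f > c there by lower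
    semicontinuity, so that h and f agree nowhere on it. *)
Lemma quasi_continuous_essential_eq {R : realType} {T : topologicalType}
    {U : Type} (h f : T -> \bar R) (Phi : T -> set U) (W : set U) (y : T) :
  quasi_continuous_on_domain h -> (forall z, -oo < h z) ->
  lower_semicontinuous f -> (forall z, h z <= f z) ->
  W `<=` \bigcup_(z in ldom h `&` [set z | f z = h z]) Phi z ->
  relative_interior (edom h) (topologically_essential (ldom h) Phi W) y ->
  f y = h y.
Proof.
move=> h_qc hNy f_lsc hf cov [hy yint].
apply/eqP; rewrite eq_le hf andbT leNgt; apply/negP => hfy.
have [c [hc cf]] : exists c : R, h y < c%:E /\ c%:E < f y.
  have [v yv] : exists v : R, h y = v%:E by exists (fine (h y)); rewrite fineK.
  have /ereal_lt_approx[s sv fs] : - f y < (- v)%:E by rewrite EFinN -yv lteN2.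
  by exists (- s)%R; rewrite yv lte_fin EFinN lteNl; split => //; lra.
have [V yV Vf] := f_lsc y c cf.
have near_edom (z : T) (A : set T) : edom h z ->
    nbhs (z : subspace (edom h)) A <-> nbhs z [set t | edom h t -> A t].
  by move=> hz; rewrite /nbhs /= -nbhs_subspace_in.
have /(_ y hc) := h_qc _ (@open_ereal_lt_ereal R c%:E).
move=> /(_ (V `&` edom h `&` topologically_essential (ldom h) Phi W)).
case.
  have /near_edom := yint => /(_ hy) yZ; apply/near_edom => //.
  by apply: filterS2 yV yZ => z Vz zZ hz; split; [|exact: zZ].
move=> v [vint [[Vv hv] vZ]]; have /near_edom := vint => /(_ hv) v_lt.
have [V' vV' V'f] := f_lsc v c (Vf v Vv).
have [z [hz fhz [V'z zc]]] := topologically_essential_near cov vZ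
  (filterI vV' v_lt).
have hz_fin : edom h z by rewrite /edom /= fin_real// hNy.
by have := lt_trans (zc hz_fin) (V'f z V'z); rewrite fhz ltxx.
Qed.

(** * The generalised Gartner-Ellis theorem *)

(** Along a subsequence the forms converge on a countable localising family, and
    then everywhere by tightness. *)
Lemma weak_relative_compactness {R : realType} {Y : topologicalType}
    (phi : nat -> Y -> \bar R) (F_ : nat -> form R Y) :
  localizing phi -> asymptotically_linear F_ ->
  (exists T : R, asymp_lt F_ T (fun=> 0)) ->
  (forall l : R, exists2 K, compact K & asymp_lt F_ l (indic_max (~` K))) ->
  exists2 s : nat -> nat, {homo s : m n / (m < n)%N} &
    exists f, [/\ lower_semicontinuous f, maxplus_L (form_of_density f) &
      weak_cvg (F_ \o s) (form_of_density f)].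
Proof.
move=> phi_loc F_lin [T F_T] F_tail.
have [s s_incr [c phi_c]] := diagonal_subsequence (fun n i => F_ n (phi i)).
have sub l chi := @asymp_lt_subseq _ _ F_ s l chi s_incr.
have Fs_lin := asymptotically_linear_subseq F_lin s_incr.
exists s => //; exists (rate phi c); split; first exact: rate_lsc.
  exact: (maxplus_L_rate phi_loc phi_c (sub _ _ F_T)).
apply: (weak_cvg_rate phi_loc Fs_lin phi_c (sub _ _ F_T)) => l.
by have [K Kc /sub Kl] := F_tail l; exists K.
Qed.

Theorem corollary5p4 (R : realType) (X Y : topologicalType)
    (hX : hausdorff_space X) (hY : polish R Y)
    (b : X -> Y -> \bar R) (hb : kernel_assumptions b)
    (F_ : nat -> form R Y) (hF : forall n, QL (F_ n))
    (hrho : rho (F_ n) @[n --> \oo] --> 0)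
    (g : X -> \bar R)
    (hg : forall x, g x = limn_esup (fun n => ext (F_ n) (b x)))
    (hglim : forall x, ext (F_ n) (b x) @[n --> \oo] --> g x)
    (hYb : discrete_space Y \/
           ((forall x, continuous (b x)) /\ forall y, -oo < conjugate b g y))
    (hcoer : strongly_coercive b)
    (hqc : quasi_continuous_on_domain (conjugate b g))
    (hx0 : exists2 x0 : X, idom g x0 & exists m : R, forall y, m%:E <= b x0 y) :
  let Bg : Y -> \bar R := conjugate b g in
  let Fbar : form R Y := form_of_density Bg in
  let Phi : Y -> set X := subdifferential_inv b g in
  let Z_a : set Y := algebraically_essential (ldom Bg) Phi (idom g) in
  let Z_t : set Y := topologically_essential (ldom Bg) Phi (idom g) in
  let Z : set Y := Z_a `|` relative_interior (edom Bg) Z_t in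
  (* (i) *)
  (exists2 F : form R Y, maxplus_L F & weak_subseq_cvg F_ F) /\
  (* (ii) *)
  is_covering (ldom Bg) Phi (idom g) /\
  (* (iii) *)
  ((forall (F : form R Y) (f : Y -> \bar R),
      weak_subseq_cvg F_ F -> is_lsc_density F f -> forall y, Bg y <= f y) /\
   (forall C : set Y, closed C ->
      limn_esup (fun n => ext (F_ n) (indic_max C)) <= Fbar (indic_max C))) /\
  (* (iv) *)
  ((forall (F : form R Y) (f : Y -> \bar R),
      weak_subseq_cvg F_ F -> is_lsc_density F f -> forall y, Z y -> f y = Bg y) /\
   (forall G : set Y, open G ->
      Fbar (indic_max (G `&` Z)) <= limn_einf (fun n => ext (F_ n) (indic_max G)))) /\
  (* (v) *)
  (topologically_minimal_covering (ldom Bg) Phi (idom g) -> weak_cvg F_ Fbar).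
Proof.
move=> Bg Fbar Phi Z_a Z_t Z.
have b_fin : forall x y, b x y < +oo by case: hb.
have b_cont : forall x, continuous (b x).
  case: hYb => [Y_discr x y A Ay|[]//].
  apply: (@open_nbhs_nbhs _ y (b x @^-1` A)); split; first exact: Y_discr.
  exact: (nbhs_singleton Ay).
have F_lin : asymptotically_linear F_.
  split=> [n|e e0]; first by have [[]] := hF n.
  have := cvg_ereal_near_lt hrho (_ : 0 < e%:E); rewrite lte_fin => /(_ e0).
  by apply: filterS => n; exact: rho_quasi_additive.
have [phi phi_loc] : exists phi : nat -> Y -> \bar R, localizing phi.
  have [Y_sep [d [d_metric d_top _]]] := hY.
  exact: countable_bumps d_metric d_top Y_sep.
have [x0 gx0 [m bm]] := hx0.
have [T F_T] : exists T : R, asymp_lt F_ T (fun=> 0).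
  (* 0 <= - m + b x0, and the forms at b x0 are eventually below g x0 + 1. *)
  exists (fine (g x0) + 1 - m)%R.
  apply: (@le_asymp_lt _ _ _ _ _ (fun y => (- m)%:E + b x0 y)).
    by move=> y; rewrite EFinN addeC leeBrDr// add0e.
  apply: asymp_lt_shift => //; apply: (asymp_lt_kernel b_fin b_cont hglim).
  by rewrite -[ltLHS](fineK gx0.1) lte_fin; lra.
have F_tail (l : R) : exists2 K, compact K & asymp_lt F_ l (indic_max (~` K)).
  have [K Kc Kl] := kernel_tail F_lin b_fin b_cont hglim (l + m) hcoer gx0.
  exists K => //.
  apply: (@le_asymp_lt _ _ _ _ _ (fun y => (- m)%:E + restr (~` K) (b x0) y)).
    move=> y; rewrite /indic_max /restr; case: ifPn => _; last exact: leNye.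
    by rewrite EFinN addeC leeBrDr// add0e.
  by apply: asymp_lt_shift => //; rewrite opprK.
have limit_ge s F f : {homo s : m n / (m < n)%N} -> weak_cvg (F_ \o s) F ->
    is_lsc_density F f -> forall y, Bg y <= f y.
  move=> s_incr sF Ff; apply: (conjugate_le_density b_fin b_cont _ sF Ff) => x.
  exact: cvg_comp (cvg_subseq_infty s_incr) (@hglim x).
have subseq_limit s : {homo s : m n / (m < n)%N} ->
    exists2 t : nat -> nat, {homo t : m n / (m < n)%N} & exists f,
      [/\ lower_semicontinuous f, maxplus_L (form_of_density f) &
        weak_cvg (F_ \o (s \o t)) (form_of_density f)].
  move=> s_incr; have := @weak_relative_compactness R Y phi (F_ \o s) phi_loc.
  apply.
  - exact: asymptotically_linear_subseq F_lin s_incr.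
  - by exists T; exact: asymp_lt_subseq.
  - move=> l; have [K Kc Kl] := F_tail l.
    by exists K => //; exact: asymp_lt_subseq.
have limit_covers s F f : {homo s : m n / (m < n)%N} -> weak_cvg (F_ \o s) F ->
    is_lsc_density F f ->
    idom g `<=` \bigcup_(z in ldom Bg `&` [set z | f z = Bg z]) Phi z.
  move=> s_incr sF Ff x gx.
  have Fs_lin := asymptotically_linear_subseq F_lin s_incr.
  have Fs_g x' : ext ((F_ \o s) n) (b x') @[n --> \oo] --> g x'.
    exact: cvg_comp (cvg_subseq_infty s_incr) (@hglim x').
  have Fs_T : exists T : R, asymp_lt (F_ \o s) T (fun=> 0).
    by exists T; exact: asymp_lt_subseq.
  have [y gy] := kernel_attained Fs_lin b_fin b_cont Fs_g
    (density_local_rate_bound phi_loc Fs_lin sF Ff) Fs_T hcoer gx.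
  have [xy fy fy_fin] :=
    attained_subdifferential b_fin (limit_ge _ _ _ s_incr sF Ff) gx.1 gy.
  by exists y => //; split => //; rewrite /ldom /= /Bg -fy.
have limit_eq s F f : {homo s : m n / (m < n)%N} -> weak_cvg (F_ \o s) F ->
    is_lsc_density F f -> forall y, Z y -> f y = Bg y.
  move=> s_incr sF Ff y; have cov := limit_covers s F f s_incr sF Ff.
  have Bgf := limit_ge s F f s_incr sF Ff.
  move=> [yZ|yZ]; first exact: (algebraically_essential_mem cov).
  case: hYb => [Y_discr|[_ BgNy]]; last first.
    exact: (quasi_continuous_essential_eq hqc BgNy Ff.1 Bgf cov yZ).
  apply: (algebraically_essential_mem cov).
  apply: (topologically_essential_discrete Y_discr).
  by have [_ /interior_subset] := yZ.
split; [|split; [|split; [split|split; [split|]]]].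
- have [t t_incr [f [_ fL tf]]] := subseq_limit id (fun m n => id).
  by exists (form_of_density f) => //; exists t.
- have [t t_incr [f [f_lsc _ tf]]] := subseq_limit id (fun m n => id).
  move=> x /(limit_covers t _ f t_incr tf (conj f_lsc (fun _ _ => erefl))).
  by move=> [y [By _] xy]; exists y.
- by move=> F f [s s_incr sF] Ff; exact: limit_ge s_incr sF Ff.
- move=> C C_closed; apply: limn_esup_le => l Cl.
  have [K Kc Kl] := F_tail l.
  have C_lt : asymp_lt F_ l (indic_max C).
    apply: (varadhan_upper_bound F_lin (f := Bg) _ _ _ _ Kc).
    - exact: conjugate_local_rate_bound.
    - by exists T.
    - by move=> y; rewrite /indic_max; case: ifPn => _; rewrite ?ltry ?ltNyr.
    (* The indicator of a closed set is upper semicontinuous. *)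
    - move=> y r yr; have [Cy|nCy] := pselect (C y).
        move: yr; rewrite /indic_max mem_set// => r0; apply: nearW => z.
        by case: ifPn => _; rewrite // ltNyr.
      have yC : nbhs y (~` C).
        by apply: open_nbhs_nbhs; split => //; exact: closed_openC.
      by apply: filterS yC => z nCz; rewrite /indic_max memNset ?ltNyr.
    - apply: le_asymp_lt Kl => y; rewrite /restr /indic_max.
      by case: ifPn => // _; case: ifPn => // _; exact: leNye.
    - by move=> y; apply: le_lt_trans Cl; exact: density_ge.
  have [k kl hk] := asymp_lt_ext C_lt.
  by apply: filterS hk => n /le_trans; apply; rewrite lee_fin ltW.
- by move=> F f [s s_incr sF] Ff; exact: limit_eq s_incr sF Ff.
- move=> G G_open; apply: limn_einf_ge => a /ereal_sup_gt[_ [y _ <-]] ay.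
  have [Gy Zy] : (G `&` Z) y.
    apply: contrapT => nGZ; move: ay.
    by rewrite /indic_max memNset// addNye ltNge leNye.
  rewrite /indic_max mem_set// add0e in ay.
  have yG : nbhs y G by apply: open_nbhs_nbhs.
  have [i /nbhs_singleton /= yi Gi] := phi_loc.2 y G yG.
  have iC := (phi_loc.1 i).1.
  apply: near_infty_subseq => s s_incr.
  have [t t_incr [f [f_lsc _ tf]]] := subseq_limit s s_incr.
  have st_incr : {homo (s \o t) : m n / (m < n)%N} by move=> ? ? /t_incr/s_incr.
  have fy := limit_eq _ _ f st_incr tf (conj f_lsc (fun _ _ => erefl)) y Zy.
  have a_lt : a%:E < form_of_density f (phi i).
    by apply: lt_le_trans (density_ge f (phi i) y); rewrite yi add0e fy.
  have /filter_ex[n an] := cvg_ereal_near_gt (tf _ iC) a_lt.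
  exists (t n); apply: le_trans (ltW an) _; apply: le_ext => // z.
  rewrite /indic_max; case: ifPn; first by move=> _; exact: (phi_loc.1 i).2.
  by rewrite notin_setE => /Gi ->.
- move=> [_ Z_min] chi chiC A A_nbhs.
  suff : \forall n \near \oo, A (F_ n chi) by [].
  apply: near_infty_subseq => s s_incr.
  have [t t_incr [f [f_lsc _ tf]]] := subseq_limit s s_incr.
  have st_incr : {homo (s \o t) : m n / (m < n)%N} by move=> ? ? /t_incr/s_incr.
  have f_dens := conj f_lsc (fun _ _ => erefl) :
    is_lsc_density (form_of_density f) f.
  have fBg : f = Bg.
    apply/funext => y; have [|By] := leP +oo (Bg y).
      rewrite leye_eq => /eqP By; have := limit_ge _ _ f st_incr tf f_dens y.
      by rewrite By leye_eq => /eqP.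
    apply: (limit_eq _ _ f st_incr tf f_dens); have Zty := Z_min y By.
    case: hYb => [Y_discr|[_ BgNy]].
      by left; exact: topologically_essential_discrete.
    have hy : edom Bg y by rewrite /edom /= fin_real// BgNy.
    right; split => //; rewrite /interior /= /nbhs /= -nbhs_subspace_in//.
    by apply: nearW => z hz; apply: Z_min; rewrite /ldom /= ltey_eq hz.
  rewrite fBg in tf; have A_near : \forall n \near \oo, A (F_ (s (t n)) chi).
    exact: tf A_nbhs.
  have /filter_ex[n An] := A_near; by exists (t n).
Qed.
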